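(* For every integer $n\ge 2$, the Bernoulli number of the second kind $b_n$ is given in terms of the Stirling numbers of the first kind $s(n-1,k)$ by $$b_n=\frac1{n!}\sum_{k=1}^{n-1}(-1)^{k}\,\frac{s(n-1,k)}{(k+1)(k+2)}.$$
   Context: The (signed) Stirling numbers of the first kind $s(n,k)$, for integers $n\ge k\ge 1$, are defined by the generating function $$\frac{[\ln(1+x)]^k}{k!}=\sum_{n=k}^\infty s(n,k)\frac{x^n}{n!},\quad |x|<1.$$ The Bernoulli numbers of the second kind $b_n$, for integers $n\ge 0$, are defined by the generating function (power series expansion at $x=0$, the left side being assigned the value $1$ at $x=0$) $$\frac{x}{\ln(1+x)}=\sum_{n=0}^\infty b_n x^n.$$ *)

(* Defs.v *)
From Stdlib Require Import Arith Factorial Reals.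
From Coquelicot Require Import Coquelicot.
Open Scope R_scope.

(* [s n k] is constrained only for [n >= k >= 1]; the summation index of the
   generating function is [n = k + m]. *)
Definition is_stirling1 (s : nat -> nat -> R) : Prop :=
  forall (k : nat) (x : R), (1 <= k)%nat -> Rabs x < 1 ->
    is_series (fun m : nat => s (k + m)%nat k * (x ^ (k + m) / INR (fact (k + m))))
              (ln (1 + x) ^ k / INR (fact k)).

Definition bernoulli2_gf (x : R) : R :=
  if Req_EM_T x 0 then 1 else x / ln (1 + x).

Definition is_bernoulli2 (b : nat -> R) : Prop :=
  locally 0 (fun x : R => is_pseries b x (bernoulli2_gf x)).

(* Main.v *)
Require Import Defs.
From Stdlib Require Import Arith Factorial Reals.
From Coquelicot Require Import Coquelicot.
From Stdlib Require Import Lra Lia.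
Open Scope R_scope.

(** Write [c_k(n) = s(n,k)/n!], so that [c_k] is the coefficient sequence of
    [ln(1+x)^k / k!], and let [Q_n(y)] be the sum of the [c_k(n) y^k].
    Expanding [(1+x)^y = exp (y ln(1+x))] in powers of [y] gives
    [(1+x)^y = sum_n Q_n(y) x^n], so [Q_n(y)] is the binomial coefficient
    [y choose n].  Integrating in [y] over [0,1] turns the left side into
    [x / ln(1+x)]; hence [b_n] is the integral of [Q_n] over [0,1], that is
    [b_n = sum_k c_k(n)/(k+1)] ([bernoulli2_eq_sum]).

    The asserted formula is a second evaluation of this integral.  From
    [n Q_n(y) = y Q_(n-1)(y-1)] ([stirling_poly_shift]) and the substitution
    [y -> 1-y], the integral of [n Q_n] equals that of [(1-y) Q_(n-1)(-y)], and
    the integral of [(1-y) y^k] is [1/((k+1)(k+2))].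

    The interchange of the sum over [n] with the integral in [y] is replaced by
    an algebraic argument.  The sequence [b] is determined by its Cauchy product
    with [c_1], which is the coefficient sequence of [x].  Since
    [c_k * c_1 = (k+1) c_(k+1)], the sequence [sum_k c_k(n)/(k+1)] has as its
    product with [c_1] the sequence [sum_(k>=1) c_k(n)], and this is
    [Q_n(1) - c_0(n)], the coefficient of [x^n] in [(1+x) - 1]. *)

(** * Power series expansions near 0 *)

(** Working with germs at 0 makes all identities between coefficient sequences
    consequences of identities between functions, without tracking radii. *)
Definition expands (a : nat -> R) (f : R -> R) : Prop :=
  locally 0 (fun x : R => is_pseries a x (f x)).

Lemma ball_0_iff (r x : R) : ball (0 : R) r x <-> Rabs x < r.
Proof.
  unfold ball; simpl. unfold AbsRing_ball, abs, minus, plus, opp; simpl.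
  now replace (x + - 0)%R with x by ring.
Qed.

Lemma scal_pow_n (x a : R) (n : nat) : scal (pow_n x n) a = a * x ^ n.
Proof. rewrite pow_n_pow. apply Rmult_comm. Qed.

(** Convergence at one point [x <> 0] already forces the radius to be at least
    [|x|], because the general term must tend to 0 there. *)
Lemma expands_CV_radius_pos (a : nat -> R) (f : R -> R) :
  expands a f -> Rbar_lt 0 (CV_radius a).
Proof.
  intros [eps Heps].
  assert (He : 0 < eps) by apply cond_pos.
  assert (Hs : is_pseries a (eps / 2) (f (eps / 2))).
  { apply Heps. apply ball_0_iff. rewrite Rabs_right; lra. }
  destruct (Rbar_lt_le_dec (CV_radius a) (Rabs (eps / 2))) as [Hlt | Hle].
  - exfalso. apply (CV_disk_outside a (eps / 2) Hlt).
    apply is_lim_seq_ext with (fun k => scal (pow_n (eps / 2) k) (a k)).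
    + intros k. apply scal_pow_n.
    + apply ex_series_lim_0. exists (f (eps / 2)). exact Hs.
  - apply Rbar_lt_le_trans with (2 := Hle). simpl. rewrite Rabs_right; lra.
Qed.

Lemma locally_0_lt_CV_radius (a : nat -> R) :
  Rbar_lt 0 (CV_radius a) ->
  locally 0 (fun x : R => Rbar_lt (Rabs x) (CV_radius a)).
Proof.
  intros H. destruct (CV_radius a) as [r | | ] eqn:E; simpl in H; try easy.
  - exists (mkposreal r H). intros x Hx. simpl. now apply ball_0_iff.
  - exists (mkposreal 1 Rlt_0_1). intros x _. exact I.
Qed.

Lemma locally_0_Rabs_lt_1 : locally 0 (fun x : R => Rabs x < 1).
Proof.
  exists (mkposreal 1 Rlt_0_1). intros x Hx. now apply ball_0_iff.
Qed.

Lemma expands_ext (a : nat -> R) (f g : R -> R) :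
  locally 0 (fun x : R => f x = g x) -> expands a f -> expands a g.
Proof.
  unfold expands. intros Hfg Ha. generalize (filter_and _ _ Hfg Ha).
  apply filter_imp. intros x [<- H]. exact H.
Qed.

Lemma expands_unique (a b : nat -> R) (f : R -> R) :
  expands a f -> expands b f -> forall n, a n = b n.
Proof.
  intros Ha Hb n. apply PSeries_ext_recip.
  - now apply expands_CV_radius_pos with f.
  - now apply expands_CV_radius_pos with f.
  - unfold expands in Ha, Hb.
    generalize (filter_and _ _ Ha Hb). apply filter_imp. intros x [H1 H2].
    rewrite (is_pseries_unique _ _ _ H1). now rewrite (is_pseries_unique _ _ _ H2).
Qed.

Lemma expands_mult (a b : nat -> R) (f g : R -> R) :
  expands a f -> expands b g -> expands (PS_mult a b) (fun x => f x * g x).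
Proof.
  intros Ha Hb.
  assert (Ra := locally_0_lt_CV_radius a (expands_CV_radius_pos a f Ha)).
  assert (Rb := locally_0_lt_CV_radius b (expands_CV_radius_pos b g Hb)).
  unfold expands in *.
  generalize (filter_and _ _ (filter_and _ _ Ha Hb) (filter_and _ _ Ra Rb)).
  apply filter_imp. intros x [[H1 H2] [H3 H4]]. now apply is_pseries_mult.
Qed.

Lemma expands_plus (a b : nat -> R) (f g : R -> R) :
  expands a f -> expands b g -> expands (PS_plus a b) (fun x => f x + g x).
Proof.
  unfold expands. intros Ha Hb. generalize (filter_and _ _ Ha Hb). apply filter_imp.
  intros x [H1 H2]. now apply (is_pseries_plus a b x).
Qed.

Lemma expands_scal (c : R) (a : nat -> R) (f : R -> R) :
  expands a f -> expands (PS_scal c a) (fun x => c * f x).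
Proof.
  unfold expands. apply filter_imp. intros x H. apply (is_pseries_scal c a x); trivial.
  apply Rmult_comm.
Qed.

Lemma expands_incr_1 (a : nat -> R) (f : R -> R) :
  expands a f -> expands (PS_incr_1 a) (fun x => x * f x).
Proof.
  unfold expands. apply filter_imp. intros x H. now apply (is_pseries_incr_1 a x).
Qed.

Lemma expands_derive (a : nat -> R) (f g : R -> R) :
  expands a f -> locally 0 (fun x : R => is_derive f x (g x)) ->
  expands (PS_derive a) g.
Proof.
  intros Ha Hg.
  assert (Ra := locally_0_lt_CV_radius a (expands_CV_radius_pos a f Ha)).
  unfold expands in *.
  generalize (filter_and _ _ (filter_and _ _ (locally_locally _ _ Ha) Hg) Ra).
  apply filter_imp. intros x [[H1 H2] H3].
  replace (g x) with (Derive (PSeries a) x).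
  - now apply is_pseries_derive.
  - apply is_derive_unique. apply is_derive_ext_loc with f; trivial.
    generalize H1. apply filter_imp. intros t Ht. symmetry.
    now apply is_pseries_unique.
Qed.

(** * The normalized Stirling numbers *)

(** [s(n,k)/n!], extended by the values that the generating function of
    [ln(1+x)^k / k!] dictates for [k = 0] and for [n < k]. *)
Definition stirling_coef (s : nat -> nat -> R) (k n : nat) : R :=
  match k with
  | O => match n with O => 1 | S _ => 0 end
  | S _ => if lt_dec n k then 0 else s n k / INR (fact n)
  end.

Definition log_power (k : nat) (x : R) : R := ln (1 + x) ^ k / INR (fact k).

Lemma stirling_coef_lt (s : nat -> nat -> R) (k n : nat) :
  (n < k)%nat -> stirling_coef s k n = 0.
Proof.
  intros H. destruct k as [ | k]; [lia | ]. unfold stirling_coef.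
  now destruct (lt_dec n (S k)).
Qed.

Lemma stirling_coef_expands (s : nat -> nat -> R) (hs : is_stirling1 s) (k : nat) :
  expands (stirling_coef s k) (log_power k).
Proof.
  unfold expands. generalize locally_0_Rabs_lt_1. apply filter_imp. intros x Hx.
  unfold is_pseries, log_power. destruct k as [ | k].
  - apply is_series_decr_n with 1%nat; [lia | ].
    apply is_series_ext with (fun _ => 0).
    + intros n. unfold scal; simpl; unfold mult; simpl. ring.
    + unfold Init.Nat.pred. rewrite sum_O.
      replace (plus _ _) with 0
        by (unfold plus, opp, scal; simpl; unfold mult, one; simpl; field).
      apply filterlim_ext with (fun _ : nat => 0).
      * intros n. rewrite sum_n_const. ring.
      * apply filterlim_const.
  - apply is_series_decr_n with (S k); [lia | ].
    apply is_series_ext with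
      (fun m => s (S k + m)%nat (S k) * (x ^ (S k + m) / INR (fact (S k + m)))).
    + intros m. rewrite scal_pow_n. unfold stirling_coef.
      destruct (lt_dec (S k + m) (S k)); [lia | ].
      (* The equation was at a module type, where field does not apply. *)
      match goal with |- @eq _ ?a ?b => change (@eq R a b) end.
      field. apply INR_fact_neq_0.
    + replace (plus _ _) with (ln (1 + x) ^ S k / INR (fact (S k))).
      * apply hs; [lia | exact Hx].
      * rewrite (sum_n_ext_loc _ (fun _ => 0)).
        -- rewrite sum_n_const. unfold plus, opp; simpl. ring.
        -- intros n Hn. rewrite stirling_coef_lt by (simpl in Hn; lia).
           apply Rmult_0_r.
Qed.

Lemma is_derive_log_power (k : nat) (x : R) :
  Rabs x < 1 -> is_derive (log_power (S k)) x (log_power k x / (1 + x)).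
Proof.
  intros Hx. apply Rabs_def2 in Hx. unfold log_power.
  assert (H1 := INR_fact_neq_0 k). assert (H2 := INR_fact_neq_0 (S k)).
  assert (H3 := not_0_INR (S k) (Nat.neq_succ_0 k)).
  auto_derive; [lra | ].
  change (fact k + k * fact k)%nat with (S k * fact k)%nat.
  change (match k with 0%nat => 1 | S _ => INR k + 1 end) with (INR (S k)).
  rewrite mult_INR. field. repeat split; trivial; lra.
Qed.

(** The differential equation [(1+x) F_(k+1)' = F_k] satisfied by
    [F_k = ln(1+x)^k / k!], read on coefficients. *)
Lemma stirling_coef_rec (s : nat -> nat -> R) (hs : is_stirling1 s) (k n : nat) :
  INR (S n) * stirling_coef s (S k) (S n) =
  stirling_coef s k n - INR n * stirling_coef s (S k) n.
Proof.
  assert (HD : expands (PS_derive (stirling_coef s (S k)))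
                       (fun x => log_power k x / (1 + x))).
  { apply expands_derive with (log_power (S k)).
    - now apply stirling_coef_expands.
    - generalize locally_0_Rabs_lt_1. apply filter_imp. apply is_derive_log_power. }
  assert (H := expands_plus _ _ _ _ HD (expands_incr_1 _ _ HD)).
  apply (expands_ext _ _ (log_power k)) in H.
  - assert (E := expands_unique _ _ _ H (stirling_coef_expands s hs k) n).
    unfold PS_plus, PS_derive, PS_incr_1 in E.
    change plus with Rplus in E. rewrite <- E. destruct n as [ | n].
    + change zero with 0. simpl INR. ring.
    + ring.
  - generalize locally_0_Rabs_lt_1. apply filter_imp. intros x Hx.
    apply Rabs_def2 in Hx. field. lra.
Qed.

(** [F_k F_1 = (k+1) F_(k+1)] read on coefficients. *)
Lemma stirling_coef_mult_1 (s : nat -> nat -> R) (hs : is_stirling1 s) (k n : nat) :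
  PS_mult (stirling_coef s k) (stirling_coef s 1) n =
  INR (S k) * stirling_coef s (S k) n.
Proof.
  assert (H := expands_mult _ _ _ _ (stirling_coef_expands s hs k)
                 (stirling_coef_expands s hs 1)).
  apply (expands_unique _ (PS_scal (INR (S k)) (stirling_coef s (S k))) _ H).
  apply expands_ext with (fun x => INR (S k) * log_power (S k) x).
  - apply filter_forall. intros x. unfold log_power.
    rewrite (fact_simpl k), mult_INR. simpl (fact 1). simpl (INR 1).
    assert (H1 := INR_fact_neq_0 k).
    assert (H3 := not_0_INR (S k) (Nat.neq_succ_0 k)).
    simpl pow. field. now split.
  - apply expands_scal. now apply stirling_coef_expands.
Qed.

Lemma stirling_coef_1_1 (s : nat -> nat -> R) (hs : is_stirling1 s) :
  stirling_coef s 1 1 = 1.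
Proof.
  assert (H := stirling_coef_rec s hs 0 0). simpl in H. simpl. lra.
Qed.

(** * The binomial polynomials *)

(** As a polynomial in [y], this is the binomial coefficient [y choose n]. *)
Definition stirling_poly (s : nat -> nat -> R) (n : nat) (y : R) : R :=
  sum_f_R0 (fun k => stirling_coef s k n * y ^ k) n.

Lemma stirling_poly_rec (s : nat -> nat -> R) (hs : is_stirling1 s) (n : nat) (y : R) :
  INR (S n) * stirling_poly s (S n) y = (y - INR n) * stirling_poly s n y.
Proof.
  assert (Hshift : sum_f_R0 (fun k => stirling_coef s (S k) n * y ^ S k) n =
                   stirling_poly s n y - stirling_coef s 0 n).
  { assert (E := decomp_sum (fun k => stirling_coef s k n * y ^ k) (S n)
                   (Nat.lt_0_succ n)).
    rewrite tech5 in E. rewrite (stirling_coef_lt s (S n) n) in E by lia.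
    change (Init.Nat.pred (S n)) with n in E.
    unfold stirling_poly. simpl (y ^ 0) in E. lra. }
  unfold stirling_poly at 1. rewrite decomp_sum by lia.
  change (Init.Nat.pred (S n)) with n. change (stirling_coef s 0 (S n)) with 0.
  rewrite Rmult_0_l, Rplus_0_l, scal_sum.
  rewrite (sum_eq _ (fun k => stirling_coef s k n * y ^ k * y +
                     stirling_coef s (S k) n * y ^ S k * - INR n)).
  - rewrite plus_sum, <- !scal_sum, Hshift.
    fold (stirling_poly s n y).
    assert (H0 : INR n * stirling_coef s 0 n = 0) by (destruct n; simpl; ring).
    apply Rminus_diag_uniq.
    ring_simplify.
    rewrite H0. ring.
  - intros k _. assert (E := stirling_coef_rec s hs k n).
    replace (stirling_coef s (S k) (S n) * y ^ S k * INR (S n))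
      with (INR (S n) * stirling_coef s (S k) (S n) * y ^ S k) by ring.
    rewrite E. simpl pow. ring.
Qed.

(** The absorption identity for binomial coefficients: the falling factorial
    [y (y-1) ... (y-n)] can be built from its last factor or from its first. *)
Lemma stirling_poly_shift (s : nat -> nat -> R) (hs : is_stirling1 s) (n : nat) (y : R) :
  INR (S n) * stirling_poly s (S n) y = y * stirling_poly s n (y - 1).
Proof.
  induction n as [ | n IH].
  - rewrite stirling_poly_rec by exact hs. unfold stirling_poly; simpl. ring.
  - apply Rmult_eq_reg_l with (INR (S n)).
    + rewrite stirling_poly_rec by exact hs.
      replace (INR (S n) * ((y - INR (S n)) * stirling_poly s (S n) y))
        with ((y - INR (S n)) * (INR (S n) * stirling_poly s (S n) y)) by ring.
      rewrite IH.
      replace (INR (S n) * (y * stirling_poly s (S n) (y - 1)))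
        with (y * (INR (S n) * stirling_poly s (S n) (y - 1))) by ring.
      rewrite stirling_poly_rec by exact hs. rewrite S_INR. ring.
    + apply not_0_INR. lia.
Qed.

Lemma stirling_poly_0 (s : nat -> nat -> R) (n : nat) :
  stirling_poly s n 0 = stirling_coef s 0 n.
Proof.
  unfold stirling_poly. destruct n as [ | n].
  - simpl. ring.
  - rewrite decomp_sum by lia. rewrite (sum_eq _ (fun _ => 0)).
    + rewrite sum_cte. simpl. ring.
    + intros k _. simpl. ring.
Qed.

(** The coefficients of [1 + x]; the right side is written as the sum of those
    of [x] and of [1]. *)
Lemma stirling_poly_1 (s : nat -> nat -> R) (hs : is_stirling1 s) (n : nat) :
  stirling_poly s n 1 = PS_incr_1 (stirling_coef s 0) n + stirling_coef s 0 n.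
Proof.
  destruct n as [ | n].
  - unfold stirling_poly, PS_incr_1. change zero with 0. simpl. ring.
  - assert (E := stirling_poly_shift s hs n 1).
    replace (1 - 1) with 0 in E by ring. rewrite stirling_poly_0 in E.
    apply Rmult_eq_reg_l with (INR (S n)); [ | apply not_0_INR; lia].
    rewrite E. unfold PS_incr_1. destruct n; simpl; ring.
Qed.

(** * Bernoulli numbers of the second kind *)

(** The defining relation [(x / ln(1+x)) ln(1+x) = x], which also holds at 0
    because both sides vanish there. *)
Lemma bernoulli2_mult_1 (s : nat -> nat -> R) (b : nat -> R)
    (hs : is_stirling1 s) (hb : is_bernoulli2 b) (n : nat) :
  PS_mult b (stirling_coef s 1) n = PS_incr_1 (stirling_coef s 0) n.
Proof.
  assert (H := expands_mult _ _ _ _ hb (stirling_coef_expands s hs 1)).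
  apply (expands_unique _ _ _ H).
  apply expands_ext with (fun x => x * log_power 0 x).
  - generalize locally_0_Rabs_lt_1. apply filter_imp. intros x Hx.
    apply Rabs_def2 in Hx. unfold bernoulli2_gf, log_power. simpl.
    destruct (Req_EM_T x 0) as [-> | Hx0].
    + rewrite Rplus_0_r, ln_1. field.
    + field. apply ln_neq_0; lra.
  - apply expands_incr_1. now apply stirling_coef_expands.
Qed.

(** Division by a series of order exactly 1 is unique. *)
Lemma PS_mult_inj_order_1 (a b c : nat -> R) :
  c 0%nat = 0 -> c 1%nat <> 0 ->
  (forall n, PS_mult a c n = PS_mult b c n) -> forall n, a n = b n.
Proof.
  intros H0 H1 H n. induction n as [n IH] using lt_wf_ind.
  assert (E := H (S n)). unfold PS_mult in E. rewrite !tech5 in E.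
  replace (S n - S n)%nat with 0%nat in E by lia. rewrite H0 in E.
  destruct n as [ | n].
  - simpl in E. apply Rmult_eq_reg_r with (c 1%nat); [lra | exact H1].
  - rewrite !tech5 in E. replace (S (S n) - S n)%nat with 1%nat in E by lia.
    rewrite (sum_eq (fun k => a k * _) (fun k => b k * c (S (S n) - k)%nat)) in E.
    + apply Rmult_eq_reg_r with (c 1%nat); [lra | exact H1].
    + intros i Hi. rewrite IH; [reflexivity | lia].
Qed.

(** The mean value of the binomial polynomial on [0,1]. *)
Definition stirling_mean (s : nat -> nat -> R) (n : nat) : R :=
  sum_f_R0 (fun k => stirling_coef s k n / INR (S k)) n.

(** A range of summation independent of [n] is what allows sums over [n] and [k]
    to be exchanged. *)
Lemma stirling_mean_widen (s : nat -> nat -> R) (n N : nat) :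
  (n <= N)%nat ->
  stirling_mean s n = sum_f_R0 (fun k => stirling_coef s k n / INR (S k)) N.
Proof.
  intros H. induction H as [ | N H IH]; [reflexivity | ].
  rewrite tech5, <- IH, stirling_coef_lt by lia. unfold Rdiv. ring.
Qed.

(** Exchanging sums turns the product into [sum_k c_(k+1)(n)], since
    [c_k * c_1 = (k+1) c_(k+1)] cancels the weight [1/(k+1)].  This is [Q_n(1)]
    without its term [k = 0]. *)
Lemma stirling_mean_mult_1 (s : nat -> nat -> R) (hs : is_stirling1 s) (n : nat) :
  PS_mult (stirling_mean s) (stirling_coef s 1) n = PS_incr_1 (stirling_coef s 0) n.
Proof.
  unfold PS_mult.
  rewrite (sum_eq _ (fun j => sum_n (fun k =>
     stirling_coef s k j * stirling_coef s 1 (n - j) / INR (S k)) n)).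
  2:{ intros j Hj. rewrite (stirling_mean_widen s j n Hj), Rmult_comm, scal_sum.
      rewrite sum_n_Reals. apply sum_eq. intros k _. unfold Rdiv. ring. }
  rewrite <- sum_n_Reals, sum_n_switch, sum_n_Reals.
  rewrite (sum_eq _ (fun k => stirling_coef s (S k) n * 1 ^ S k)).
  - assert (E := decomp_sum (fun k => stirling_coef s k n * 1 ^ k) (S n)
                   (Nat.lt_0_succ n)).
    rewrite tech5, (stirling_coef_lt s (S n) n) in E by lia.
    fold (stirling_poly s n 1) in E. rewrite stirling_poly_1 in E by exact hs.
    change (Init.Nat.pred (S n)) with n in E. simpl (1 ^ 0) in E. lra.
  - intros k _. rewrite sum_n_Reals.
    assert (H3 := not_0_INR (S k) (Nat.neq_succ_0 k)).
    rewrite pow1, Rmult_1_r.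
    replace (stirling_coef s (S k) n)
      with (/ INR (S k) * (INR (S k) * stirling_coef s (S k) n)) by (now field).
    rewrite <- stirling_coef_mult_1 by exact hs. unfold PS_mult.
    rewrite scal_sum. now apply sum_eq.
Qed.

Lemma bernoulli2_eq_sum (s : nat -> nat -> R) (b : nat -> R)
    (hs : is_stirling1 s) (hb : is_bernoulli2 b) (n : nat) :
  b n = stirling_mean s n.
Proof.
  apply PS_mult_inj_order_1 with (stirling_coef s 1).
  - apply stirling_coef_lt. lia.
  - rewrite stirling_coef_1_1 by exact hs. lra.
  - intros m. rewrite (bernoulli2_mult_1 s b hs hb).
    now rewrite stirling_mean_mult_1.
Qed.

(** * Two evaluations of the integral of a binomial polynomial *)

Lemma is_RInt_sum_f_R0 (c l : nat -> R) (f : nat -> R -> R) (u v : R) (n : nat) :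
  (forall k, is_RInt (f k) u v (l k)) ->
  is_RInt (fun y => sum_f_R0 (fun k => c k * f k y) n) u v
          (sum_f_R0 (fun k => c k * l k) n).
Proof.
  intros H. induction n as [ | n IH]; simpl.
  - now apply (is_RInt_scal (f 0%nat)).
  - apply (is_RInt_plus _ (fun y => c (S n) * f (S n) y)); [exact IH | ].
    now apply (is_RInt_scal (f (S n))).
Qed.

Lemma is_RInt_pow (k : nat) : is_RInt (fun y => y ^ k) 0 1 (1 / INR (S k)).
Proof.
  assert (H3 := not_0_INR (S k) (Nat.neq_succ_0 k)).
  replace (1 / INR (S k))
    with (minus ((fun y => y ^ S k / INR (S k)) 1) ((fun y => y ^ S k / INR (S k)) 0)).
  - apply (is_RInt_derive (fun y => y ^ S k / INR (S k))).
    + intros x _. auto_derive; trivial.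
      change (Init.Nat.pred (S k)) with k. now field.
    + intros x _. apply (ex_derive_continuous (fun y => y ^ k)). now auto_derive.
  - change (1 ^ S k / INR (S k) + - (0 ^ S k / INR (S k)) = 1 / INR (S k)).
    rewrite pow1, pow_ne_zero by lia. now field.
Qed.

Lemma is_RInt_stirling_poly (s : nat -> nat -> R) (n : nat) :
  is_RInt (stirling_poly s n) 0 1 (stirling_mean s n).
Proof.
  unfold stirling_mean.
  rewrite (sum_eq _ (fun k => stirling_coef s k n * (1 / INR (S k)))).
  - apply (is_RInt_sum_f_R0 _ _ (fun k y => y ^ k)). exact is_RInt_pow.
  - intros k _. unfold Rdiv. ring.
Qed.

Lemma is_RInt_reflect (f : R -> R) (l : R) :
  is_RInt f 0 1 l -> is_RInt (fun y => f (1 - y)) 0 1 l.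
Proof.
  intros H. apply is_RInt_swap in H.
  replace l with (opp (opp l)) by apply opp_opp.
  apply is_RInt_ext with (fun y => opp (scal (-1) (f (-1 * y + 1)))).
  - intros y _. replace (-1 * y + 1) with (1 - y) by ring.
    unfold scal, opp; simpl; unfold mult; simpl. ring.
  - apply (is_RInt_opp (fun y => scal (-1) (f (-1 * y + 1)))).
    apply (is_RInt_comp_lin f (-1) 1).
    replace (-1 * 0 + 1) with 1 by ring. now replace (-1 * 1 + 1) with 0 by ring.
Qed.

(** Reflection [y -> 1-y] turns the absorbed form [y Q_n(y-1)] of the integrand
    into [(1-y) Q_n(-y)], which is a combination of the [y^k - y^(k+1)]. *)
Lemma stirling_mean_S (s : nat -> nat -> R) (hs : is_stirling1 s) (n : nat) :
  INR (S n) * stirling_mean s (S n) =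
  sum_f_R0 (fun k => (-1) ^ k * stirling_coef s k n *
                     (1 / ((INR k + 1) * (INR k + 2)))) n.
Proof.
  assert (H1 := is_RInt_scal _ _ _ (INR (S n)) _
                  (is_RInt_reflect _ _ (is_RInt_stirling_poly s (S n)))).
  assert (H2 : is_RInt (fun y => sum_f_R0 (fun k =>
                 (-1) ^ k * stirling_coef s k n * (y ^ k - y ^ S k)) n) 0 1
               (sum_f_R0 (fun k => (-1) ^ k * stirling_coef s k n *
                     (1 / ((INR k + 1) * (INR k + 2)))) n)).
  { apply (is_RInt_sum_f_R0 _ _ (fun k y => y ^ k - y ^ S k)). intros k.
    replace (1 / ((INR k + 1) * (INR k + 2)))
      with (minus (1 / INR (S k)) (1 / INR (S (S k)))).
    - apply (is_RInt_minus (fun y => y ^ k) (fun y => y ^ S k));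
        apply is_RInt_pow.
    - change (1 / INR (S k) - 1 / INR (S (S k)) = 1 / ((INR k + 1) * (INR k + 2))).
      rewrite !S_INR. assert (Hk := pos_INR k). field. lra. }
  rewrite <- (is_RInt_unique _ _ _ _ H2).
  apply (eq_trans (eq_sym (is_RInt_unique _ _ _ _ H1))).
  apply RInt_ext. intros y _.
  change (INR (S n) * stirling_poly s (S n) (1 - y) =
          sum_f_R0 (fun k => (-1) ^ k * stirling_coef s k n * (y ^ k - y ^ S k)) n).
  rewrite stirling_poly_shift by exact hs.
  replace (1 - y - 1) with (-1 * y) by ring.
  unfold stirling_poly. rewrite scal_sum. apply sum_eq. intros k _.
  rewrite Rpow_mult_distr. simpl pow. ring.
Qed.

Theorem theorem1p1 (s : nat -> nat -> R) (b : nat -> R)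
    (hs : is_stirling1 s) (hb : is_bernoulli2 b) (n : nat) (hn : (2 <= n)%nat) :
  b n = 1 / INR (fact n) *
        sum_n_m (fun k : nat =>
          (-1) ^ k * (s (n - 1)%nat k / ((INR k + 1) * (INR k + 2)))) 1 (n - 1).
Proof.
  destruct n as [ | [ | m]]; [lia | lia | ].
  replace (S (S m) - 1)%nat with (S m) by lia.
  rewrite (bernoulli2_eq_sum s b hs hb).
  assert (HN := not_0_INR (S (S m)) (Nat.neq_succ_0 (S m))).
  assert (HF := INR_fact_neq_0 (S m)).
  apply Rmult_eq_reg_l with (INR (S (S m))); [ | exact HN].
  rewrite stirling_mean_S by exact hs.
  rewrite <- sum_n_m_S. fold (sum_n (fun k : nat =>
    (-1) ^ S k * (s (S m) (S k) / ((INR (S k) + 1) * (INR (S k) + 2)))) m).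
  rewrite sum_n_Reals, fact_simpl, mult_INR.
  (* The term k = 0 vanishes because S m is positive. *)
  rewrite decomp_sum by lia. simpl Init.Nat.pred.
  change (stirling_coef s 0 (S m)) with 0.
  rewrite Rmult_0_r, Rmult_0_l, Rplus_0_l.
  rewrite <- Rmult_assoc, scal_sum. apply sum_eq. intros k Hk.
  unfold stirling_coef. destruct (lt_dec (S m) (S k)); [lia | ].
  assert (Hp := pos_INR (S k)). field. repeat split; trivial; lra.
Qed.
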